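(* Let $(L,E)$ be a tree, and for each edge $\{x,y\}\in E$ let an amplitude matrix $(\psi_{xy}(i,j))_{i,j=1}^d$ be given. Let $\psi_\Lambda\in\mathcal H_\Lambda$ ($\Lambda\subseteq L$ finite) be the associated vectors. Then for every finite connected $\Lambda\subseteq L$ of cardinality $\ge 2$ one has $$\|\psi_\Lambda\|^2=d,$$ and the limit $$\varphi(a)=\frac1d\lim_{\Lambda\uparrow L}\langle\psi_\Lambda,a\,\psi_\Lambda\rangle$$ (over finite connected subsets $\Lambda\subseteq L$ increasing to $L$) exists for every $a$ in the local algebra $\mathcal B_{L,\mathrm{loc}}$ and defines a state $\varphi$ on $\mathcal B_L$.
   Context: Graphs: $\mathcal G=(L,E)$ is a non-oriented simple graph with $L$ non-empty and at most countable, $E\subset\{\{x,y\}:x\ne y\in L\}$; write $x\sim y$ if $\{x,y\}\in E$. All graphs are connected and locally finite (every vertex has finitely many neighbours). A tree is a connected graph without loops (cycles). A subset $\Lambda\subseteq L$ is connected if any two of its vertices are joined by a walk inside $\Lambda$. Algebras: fix $d\in\mathbb N$. To each $x\in L$ is associated a Hilbert space $\mathcal H_x$ of dimension $d$ with a fixed orthonormal basis $e_1(x),\dots,e_d(x)$. For finite $\Lambda\subseteq L$, $\mathcal H_\Lambda=\bigotimes_{x\in\Lambda}\mathcal H_x$, $\mathcal B_\Lambda=\mathcal B(\mathcal H_\Lambda)$; for $\Lambda\subseteq\Lambda_1$ the algebra $\mathcal B_\Lambda$ is identified with $\mathcal B_\Lambda\otimes I\subseteq\mathcal B_{\Lambda_1}$.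 $\mathcal B_{L,\mathrm{loc}}=\bigcup_{\Lambda\text{ finite}}\mathcal B_\Lambda$, and $\mathcal B_L$ is its $C^*$-inductive limit (the infinite $C^*$-tensor product $\bigotimes_{x\in L}\mathcal B_x$). For a configuration $\omega_\Lambda:\Lambda\to\{1,\dots,d\}$ put $e_{\omega_\Lambda}=\bigotimes_{x\in\Lambda}e_{\omega_\Lambda(x)}(x)$. Amplitude matrices: for each edge $\{x,y\}$, an amplitude matrix is a complex $d\times d$ matrix $(\psi_{xy}(i,j))$ such that $\sum_{i=1}^d|\psi_{xy}(i,j)|^2=1$ for all $j$ and $\sum_{j=1}^d|\psi_{xy}(i,j)|^2=1$ for all $i$. First index refers to $x$ and second to $y$, with the convention $\psi_{yx}(j,i)=\psi_{xy}(i,j)$. For finite $\Lambda\subseteq L$ let $E_\Lambda=\{\{x,y\}:x,y\in\Lambda,\ x\sim y\}$ and $$\psi_\Lambda=\sum_{\omega_\Lambda}\psi_\Lambda(\omega_\Lambda)\,e_{\omega_\Lambda},\qquad \psi_\Lambda(\omega_\Lambda)=\prod_{\{x,y\}\in E_\Lambda}\psi_{xy}(\omega_\Lambda(x),\omega_\Lambda(y)),$$ where the sum is over all configurations on $\Lambda$. ''Defines a state on $\mathcal B_L$'' means that the functional on $\mathcal B_{L,\mathrm{loc}}$ extends (uniquely, by continuity) to a state on $\mathcal B_L$. *)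

(* Defs.v *)
From HB Require Import structures.
From mathcomp Require Import all_boot all_order all_algebra finmap.
From mathcomp Require Import all_classical all_reals all_analysis.
From mathcomp Require Export complex.

Set Implicit Arguments.
Unset Strict Implicit.
Unset Printing Implicit Defensive.

Import Order.TTheory GRing.Theory Num.Theory.
Import numFieldNormedType.Exports.
Local Open Scope classical_set_scope.
Local Open Scope ring_scope.

Definition simple_graph (L : eqType) (e : rel L) : Prop :=
  symmetric e /\ irreflexive e.

Definition locally_finite (L : eqType) (e : rel L) : Prop :=
  forall x : L, finite_set [set y | e x y].

Definition connected_graph (L : eqType) (e : rel L) : Prop :=
  forall x y : L, exists2 p : seq L, path e x p & last x p = y.

(* A cycle of a simple graph has at least three vertices; the pairs [:: x; y]
   with x ~ y also satisfy [ucycle e] and have to be excluded. *)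
Definition acyclic_graph (L : eqType) (e : rel L) : Prop :=
  forall p : seq L, (2 < size p)%N -> ~ ucycle e p.

Definition tree (L : eqType) (e : rel L) : Prop :=
  [/\ simple_graph e, connected_graph e & acyclic_graph e].

Definition connected_in (L : choiceType) (e : rel L) (A : {fset L}) : Prop :=
  forall x y : L, x \in A -> y \in A ->
  exists p : seq L, [/\ path e x p, {subset p <= A} & last x p = y].

(* The filter of the net of finite connected subsets increasing to L. *)
Definition exhaustion (L : choiceType) (e : rel L) : set_system {fset L} :=
  filter_from setT
    (fun A : {fset L} => [set B | connected_in e B /\ (A `<=` B)%fset]).

Definition conf (L : choiceType) (d : nat) (A : {fset L}) : finType :=
  {ffun A -> 'I_d}.

(* The tensor product of the H_x, x in A, in coordinates with respect to its
   orthonormal basis (e_w) indexed by the configurations w on A. *)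
Definition hilb (K : numClosedFieldType) (d : nat) (L : choiceType)
    (A : {fset L}) : vectType K :=
  {ffun conf d A -> K^o}.

Notation local_alg K d A := 'End(hilb K d A) (only parsing).

Definition inner (K : numClosedFieldType) (d : nat) (L : choiceType)
    (A : {fset L}) (u v : hilb K d A) : K :=
  \sum_(w : conf d A) (u w)^* * v w.

Definition basis_vec (K : numClosedFieldType) (d : nat) (L : choiceType)
    (A : {fset L}) (w : conf d A) : hilb K d A :=
  [ffun w' => (w' == w)%:R].

Definition adj (K : numClosedFieldType) (d : nat) (L : choiceType)
    (A : {fset L}) (a : local_alg K d A) : local_alg K d A :=
  linfun (fun v : hilb K d A =>
    [ffun w => inner (a (basis_vec K w)) v] : hilb K d A).

Definition restr (d : nat) (L : choiceType) (A B : {fset L})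
    (h : (A `<=` B)%fset) (w : conf d B) : conf d A :=
  [ffun x => w (fincl h x)].

Definition glue (d : nat) (L : choiceType) (A B : {fset L})
    (u : conf d A) (w : conf d B) : conf d B :=
  [ffun x => if insub (val x) is Some y then u y else w x].

(* The operator a (x) I: [a] acts on the variables in A with those in B \ A
   kept fixed (see [extendE]). *)
Definition extend (K : numClosedFieldType) (d : nat) (L : choiceType)
    (A B : {fset L}) (h : (A `<=` B)%fset) (a : local_alg K d A) :
    local_alg K d B :=
  linfun (fun v : hilb K d B =>
    [ffun w => a ([ffun u => v (glue u w)] : hilb K d A) (restr h w)]
      : hilb K d B).

Definition amplitude_matrix (K : numClosedFieldType) (d : nat)
    (M : 'M[K]_d) : Prop :=
  (forall j, \sum_i `|M i j| ^+ 2 = 1) /\ (forall i, \sum_j `|M i j| ^+ 2 = 1).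

Definition amplitudes (K : numClosedFieldType) (d : nat) (L : eqType)
    (e : rel L) (psi : L -> L -> 'M[K]_d) : Prop :=
  forall x y, e x y ->
    amplitude_matrix (psi x y) /\ (forall i j, psi y x j i = psi x y i j).

(* The condition on [pickle] lets every unordered edge inside A occur exactly
   once; by the symmetry in [amplitudes] the chosen orientation of the edge is
   irrelevant. *)
Definition psi_vec (K : numClosedFieldType) (d : nat) (L : countType)
    (e : rel L) (psi : L -> L -> 'M[K]_d) (A : {fset L}) : hilb K d A :=
  [ffun w : conf d A =>
    \prod_(p : A * A | e (val p.1) (val p.2) &&
                       (choice.pickle (val p.1) < choice.pickle (val p.2))%N)
      psi (val p.1) (val p.2) (w p.1) (w p.2)].

(* <psi_B, a psi_B> for [a] in the local algebra of A, meaningful if A is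
   included in B; the junk value 0 is irrelevant along [exhaustion]. *)
Definition expect (K : numClosedFieldType) (d : nat) (L : countType)
    (e : rel L) (psi : L -> L -> 'M[K]_d) (A : {fset L})
    (a : local_alg K d A) (B : {fset L}) : K :=
  if @idP (A `<=` B)%fset is ReflectT h
  then inner (psi_vec e psi B) (extend h a (psi_vec e psi B)) else 0.

(* Unital C*-algebras.  The multiplication is an explicit field because
   HB has no join of the ring structures with the normed ones below
   numDomainType. *)
Record cstarAlgType (K : numClosedFieldType) : Type := CStarAlgebra {
  cstar_sort :> completeNormedModType K ;
  cmul : cstar_sort -> cstar_sort -> cstar_sort ;
  cone : cstar_sort ;
  star : cstar_sort -> cstar_sort ;
  cmulA : associative cmul ;
  cmul1l : left_id cone cmul ;
  cmul1r : right_id cone cmul ;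
  cmulDl : left_distributive cmul +%R ;
  cmulDr : right_distributive cmul +%R ;
  cmulZl : forall (c : K) a b, cmul (c *: a) b = c *: cmul a b ;
  cmulZr : forall (c : K) a b, cmul a (c *: b) = c *: cmul a b ;
  starK : involutive star ;
  starD : {morph star : a b / a + b} ;
  starZ : forall (c : K) a, star (c *: a) = c^* *: star a ;
  starM : forall a b, star (cmul a b) = cmul (star b) (star a) ;
  norm_cmul_le : forall a b, `|cmul a b| <= `|a| * `|b| ;
  norm_star_cmul : forall a, `|cmul (star a) a| = `|a| ^+ 2
}.

(* [B] with the maps [iota] is the C*-inductive limit of the local algebras:
   this determines [B] up to unique *-isomorphism.  Injective *-homomorphisms
   between C*-algebras are isometric, so no norm on the local algebras is
   needed. *)
Record inductive_limit (K : numClosedFieldType) (d : nat) (L : choiceType)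
    (B : cstarAlgType K)
    (iota : forall A : {fset L}, local_alg K d A -> B) : Prop :=
  InductiveLimit {
    iota_linear : forall A, linear (iota A) ;
    iota1 : forall A, iota A \1%VF = cone B ;
    iotaM : forall A (a b : local_alg K d A),
      iota A (a \o b)%VF = cmul (iota A a) (iota A b) ;
    iota_star : forall A (a : local_alg K d A),
      iota A (adj a) = star (iota A a) ;
    iota_inj : forall A, injective (iota A) ;
    iota_extend : forall A A' (h : (A `<=` A')%fset) (a : local_alg K d A),
      iota A' (extend h a) = iota A a ;
    iota_dense : dense (\bigcup_(A in setT) range (iota A))
  }.

Definition is_state (K : numClosedFieldType) (B : cstarAlgType K)
    (phi : {linear B -> K^o}) : Prop :=
  (forall b, 0 <= (phi (cmul (star b) b) : K)) /\ phi (cone B) = 1.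

Lemma extendE (K : numClosedFieldType) (d : nat) (L : choiceType)
    (A B : {fset L}) (h : (A `<=` B)%fset) (a : local_alg K d A)
    (v : hilb K d B) (w : conf d B) :
  extend h a v w = a ([ffun u => v (glue u w)] : hilb K d A) (restr h w).
Proof.
set f := fun v : hilb K d B =>
  [ffun w => a ([ffun u => v (glue u w)] : hilb K d A) (restr h w)]
    : hilb K d B.
have lf : linear f.
  move=> c x y; apply/ffunP=> w'; rewrite !ffunE.
  have -> : ([ffun u => (c *: x + y) (glue u w')] : hilb K d A) =
      c *: ([ffun u => x (glue u w')] : hilb K d A) + [ffun u => y (glue u w')].
    by apply/ffunP=> u; rewrite !ffunE.
  by rewrite linearP !ffunE.
pose mf := GRing.isLinear.Build K (hilb K d B) (hilb K d B) _ f lf.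
pose lF : {linear hilb K d B -> hilb K d B} := HB.pack f mf.
have -> : extend h a = linfun lF by [].
by rewrite lfunE /= ffunE.
Qed.

Lemma adjP (K : numClosedFieldType) (d : nat) (L : choiceType)
    (A : {fset L}) (a : local_alg K d A) (u v : hilb K d A) :
  inner u (adj a v) = inner (a u) v.
Proof.
set f := fun v : hilb K d A =>
  [ffun w => inner (a (basis_vec K w)) v] : hilb K d A.
have lf : linear f.
  move=> c x y; apply/ffunP=> w'; rewrite !ffunE /inner.
  rewrite scaler_sumr -big_split /=; apply: eq_bigr => i _.
  by rewrite !ffunE mulrDr /GRing.scale /= mulrCA.
pose mf := GRing.isLinear.Build K (hilb K d A) (hilb K d A) _ f lf.
pose lF : {linear hilb K d A -> hilb K d A} := HB.pack f mf.
have -> : adj a = linfun lF by [].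
have uE : u = \sum_w u w *: basis_vec K w.
  apply/ffunP=> w'; rewrite sum_ffunE (bigD1 w') //= big1 ?addr0.
    by rewrite !ffunE eqxx /GRing.scale /= mulr1.
  by move=> i ni; rewrite !ffunE eq_sym (negbTE ni) /GRing.scale /= mulr0.
rewrite [in RHS]uE linear_sum /inner.
under eq_bigr do rewrite lfunE /= ffunE /inner mulr_sumr.
rewrite exchange_big; apply: eq_bigr => w' _ /=.
rewrite sum_ffunE rmorph_sum mulr_suml; apply: eq_bigr => w _.
by rewrite linearZ !ffunE /GRing.scale /= rmorphM mulrA.
Qed.

(* Main.v *)
Require Import Defs.
From HB Require Import structures.
From mathcomp Require Import all_boot all_order all_algebra finmap.
From mathcomp Require Import all_classical all_reals all_analysis.
From mathcomp Require Import ring lra.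
Import Order.TTheory GRing.Theory Num.Theory.
Import numFieldNormedType.Exports.
Local Open Scope classical_set_scope.
Local Open Scope ring_scope.

Set Implicit Arguments.
Unset Strict Implicit.
Unset Printing Implicit Defensive.

(** Everything rests on the removal of one leaf.  If B is a finite connected
set of vertices of a tree and z is a vertex outside B adjacent to x in B, then
x is the only neighbour of z in B, since a second one would close a cycle
([tree_leaf_unique]).  Hence psi_(B + z)(w) = psi_xz(w x, w z) psi_B(w | B).
If the operator a acts on a set A inside B that does not contain x, it leaves
both w x and w z alone, so the new factor enters <psi, a psi> only through
sum_k |psi_xz(w x, k)|^2 = 1 and <psi, a psi> does not change
([expect_leaf]).

Any finite connected set grows out of a nonempty connected subset by attaching
such vertices one at a time ([connected_growth_ind]).  Growing from a single
vertex x, where psi is constantly 1, with a = 1 acting on the empty set, gives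
||psi_B||^2 = d ([norm_psi_vec]).  Growing from a connected D that contains A
and all neighbours of A, no new vertex is ever attached to a vertex of A, so
<psi_B, a psi_B> is constant for B containing D ([expect_stable]): the net is
eventually constant.  This is where local finiteness is used.

The limit is thus, on any finite set of local observables, a vector
expectation d^-1 <psi_B, a psi_B> with ||psi_B||^2 = d, hence linear, positive
and normalised.  Its continuity for the C*-norm comes from the rank-one
operator P = |psi><psi|: with p the image of P one has p* = p,
p p = <psi, psi> p and p (iota a) p = <psi, a psi> p.  The C*-identity gives
|p| = <psi, psi>, as p is nonzero by injectivity of iota, and then
|<psi, a psi>| <= <psi, psi> |iota a| ([inner_iota_le]).  A bounded functional
on a dense subspace extends to the whole algebra ([bounded_extension]),
uniquely by continuity, and the extension stays positive because b |-> b* b is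
continuous. *)

(** * Finite connected sets in trees *)

Lemma connected_in1 (L : choiceType) (e : rel L) (x : L) :
  connected_in e [fset x]%fset.
Proof. by move=> u v /fset1P-> /fset1P->; exists [::]; split. Qed.

Lemma connected_inU1 (L : choiceType) (e : rel L) (B : {fset L}) (x z : L) :
  symmetric e -> connected_in e B -> x \in B -> e x z ->
  connected_in e (z |` B)%fset.
Proof.
move=> syme cB xB exz u v uC vC.
have [p [pp ps pl]] : exists p, [/\ path e u p, {subset p <= (z |` B)%fset}
    & last u p = x].
  case/fset1UP: uC => [->|uB].
    exists [:: x]; split=> //=; first by rewrite syme exz.
    by move=> y; rewrite mem_seq1 => /eqP->; rewrite fset1Ur.
  have [p [pp ps pl]] := cB u x uB xB; exists p; split=> // y /ps.
  exact: fset1Ur.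
have [q [qp qs ql]] : exists p, [/\ path e x p, {subset p <= (z |` B)%fset}
    & last x p = v].
  case/fset1UP: vC => [->|vB].
    exists [:: z]; split=> //=; first by rewrite exz.
    by move=> y; rewrite mem_seq1 => /eqP->; rewrite fset1U1.
  have [q [qp qs ql]] := cB x v xB vB; exists q; split=> // y /qs.
  exact: fset1Ur.
exists (p ++ q); rewrite cat_path last_cat pl pp qp; split=> // y.
by rewrite mem_cat => /orP[/ps|/qs].
Qed.

(** A simple path in B from x to a second neighbour y would, together with z,
be a cycle. *)
Lemma tree_leaf_unique (L : choiceType) (e : rel L) (B : {fset L})
    (x y z : L) :
  tree e -> connected_in e B -> z \notin B -> x \in B -> y \in B ->
  e x z -> e y z -> y = x.
Proof.
move=> [[syme _] _ acyc] cB zB xB yB exz eyz; apply/eqP/negPn/negP => nyx.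
have [p [pp ps pl]] := cB x y xB yB.
case/shortenP: pp pl => p' pp' up' sub pl.
apply: (acyc [:: z, x & p']).
  by case: p' {pp' up' sub} pl nyx => //= ->; rewrite eqxx.
rewrite /ucycle /cycle /= syme exz rcons_path pp' pl eyz /=.
move: up' => /= ->; rewrite andbT inE negb_or; apply/andP; split.
  by apply: contraNneq zB => ->.
by apply: contraNN zB => /sub /ps.
Qed.

Lemma path_exit (T : eqType) (e : rel T) (P : pred T) (u : T) (p : seq T) :
  path e u p -> P u -> ~~ P (last u p) ->
  exists x z, [/\ P x, ~~ P z, e x z & z \in p].
Proof.
elim: p u => [|v p IH] u /=; first by move=> _ ->.
move=> /andP[euv pv] Pu nP; have [Pv|nPv] := boolP (P v).
  have [x [z [? ? ? zp]]] := IH v pv Pv nP.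
  by exists x, z; split=> //; rewrite inE zp orbT.
by exists u, v; split=> //; rewrite inE eqxx.
Qed.

(** Follow a path inside C from B to a point of C outside B: the first step
that leaves B provides the vertex z to attach.  The set stays connected and
the number of missing vertices drops. *)
Lemma connected_growth_ind (L : choiceType) (e : rel L) (B C : {fset L})
    (P : {fset L} -> Prop) :
  symmetric e -> connected_in e B -> B != fset0 -> connected_in e C ->
  (B `<=` C)%fset -> P B ->
  (forall (D : {fset L}) x z, connected_in e D -> (B `<=` D)%fset ->
     x \in D -> z \notin D -> e x z -> P D -> P (z |` D)%fset) ->
  P C.
Proof.
move=> syme cB B0 cC BC PB step.
have [n] := ubnP #|` (C `\` B)%fset|; elim: n B cB B0 BC PB step => // n IH.
move=> B cB B0 BC PB step ltn.
have [CB|/fsubsetPn[v vC vB]] := boolP (C `<=` B)%fset.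
  suff -> : C = B by [].
  by apply/eqP; rewrite eqEfsubset CB BC.
have /fset0Pn[u uB] := B0.
have [p [pp ps pl]] := cC u v (fsubsetP BC u uB) vC.
have [|x [z [xB zB exz /ps zC]]] := path_exit (P := mem B) pp uB.
  by rewrite pl.
have zBC : (z |` B `<=` C)%fset by rewrite fsubUset fsub1set zC.
apply: (IH (z |` B)%fset) => //.
- exact: connected_inU1 exz.
- by apply/fset0Pn; exists z; rewrite fset1U1.
- exact: step exz PB.
- move=> D y t cD /fsubUsetP[_ BD]; exact: step.
- rewrite ltnS in ltn; apply: leq_trans ltn.
  rewrite (cardfsD1 z (C `\` B)%fset).
  by rewrite in_fsetD zC zB add1n ltnS fsetDDl fsetUC.
Qed.

Lemma connected_hull (L : choiceType) (e : rel L) (A : {fset L}) :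
  inhabited L -> symmetric e -> connected_graph e ->
  exists D : {fset L}, [/\ connected_in e D, (A `<=` D)%fset & D != fset0].
Proof.
move=> [x0] syme conn; elim/fset1U_rect: A => [|a A aA [D [cD AD D0]]].
  exists [fset x0]%fset; split=> //; first exact: connected_in1.
  by apply/fset0Pn; exists x0; rewrite inE.
have /fset0Pn[u uD] := D0; have [p pp pl] := conn u a.
suff [D' [cD' DD' aD']] : exists D' : {fset L},
    [/\ connected_in e D', (D `<=` D')%fset & a \in D'].
  exists D'; split=> //.
    by rewrite fsubUset fsub1set aD' (fsubset_trans AD).
  by apply/fset0Pn; exists a.
elim: p u D uD cD pp pl {AD D0} => [|v p IH] u D uD cD /=.
  by move=> _ <-; exists D.
move=> /andP[euv pp] pl.
have [||||D' [cD' /fsubUsetP[_ DD'] aD']] := IH v (v |` D)%fset.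
- exact: fset1U1.
- exact: connected_inU1 uD euv.
- exact: pp.
- exact: pl.
by exists D'.
Qed.

Lemma locally_finite_nbh (L : choiceType) (e : rel L) (A : {fset L}) :
  locally_finite e ->
  exists N : {fset L}, forall x y, x \in A -> e x y -> y \in N.
Proof.
move=> lf; have fN : finite_set (\bigcup_(x in [set` A]) [set y | e x y]).
  by apply: bigcup_finite => // x _; exact: lf.
exists (fset_set (\bigcup_(x in [set` A]) [set y | e x y])) => x y xA exy.
by rewrite in_fset_set // inE; exists x.
Qed.

(** * Attaching a leaf *)

(** The same product as in [psi_vec], over the edges inside A, for a
configuration f defined on all of L.  Iterating over the finite set A instead
of the type of its elements lets A grow without transporting dependent
indices. *)
Definition amplitude (K : numClosedFieldType) (d : nat) (L : countType)
    (e : rel L) (psi : L -> L -> 'M[K]_d) (A : {fset L}) (f : L -> 'I_d) : K :=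
  \prod_(x <- A) \prod_(y <- A)
    (if e x y && (choice.pickle x < choice.pickle y)%N
     then psi x y (f x) (f y) else 1).

Lemma psi_vecE (K : numClosedFieldType) (d : nat) (L : countType)
    (e : rel L) (psi : L -> L -> 'M[K]_d) (A : {fset L}) (f : L -> 'I_d)
    (w : conf d A) :
  (forall x : A, w x = f (val x)) -> psi_vec e psi A w = amplitude e psi A f.
Proof.
move=> wf; rewrite ffunE /amplitude big_seq_fsetE /= big_mkcond /=.
under [RHS]eq_bigr do rewrite big_seq_fsetE /=.
by rewrite pair_big /=; apply: eq_bigr => -[x y] _ /=; rewrite !wf.
Qed.

(** Among the pairs that involve the new vertex z only (x, z) and (z, x) are
edges, and the order given by [pickle] keeps exactly one of them; which one is
irrelevant by the symmetry of the amplitudes. *)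
Lemma amplitude_leaf (K : numClosedFieldType) (d : nat) (L : countType)
    (e : rel L) (psi : L -> L -> 'M[K]_d) (B : {fset L}) (x z : L)
    (f : L -> 'I_d) :
  simple_graph e -> amplitudes e psi -> x \in B -> z \notin B -> e x z ->
  (forall y, y \in B -> e y z -> y = x) ->
  amplitude e psi (z |` B)%fset f = psi x z (f x) (f z) * amplitude e psi B f.
Proof.
move=> [syme irre] amp xB zB exz leaf; rewrite /amplitude big_fsetU1 //=.
under [in X in _ * X]eq_bigr do rewrite big_fsetU1 //=.
rewrite big_split /= mulrA; congr (_ * _).
rewrite big_fsetU1 //= irre mul1r -big_split /= (big_fsetD1 x) //=.
rewrite big_seq_cond big1 => [|y /andP[]].
  rewrite mulr1 exz syme exz /=; have [_ ->] := amp x z exz.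
  have : choice.pickle x != choice.pickle z.
    by apply: contraNneq zB => /(pcan_inj choice.pickleK) <-.
  by case: ltngtP; rewrite ?mulr1 ?mul1r.
rewrite in_fsetD1 => /andP[yx yB] _.
have eyz : e y z = false by apply: contraNF yx => /(leaf y yB)->.
by rewrite syme eyz mul1r.
Qed.

Lemma psi_vec_leaf (K : numClosedFieldType) (d : nat) (L : countType)
    (e : rel L) (psi : L -> L -> 'M[K]_d) (B : {fset L}) (x z : L)
    (xB : x \in B) (w : conf d (z |` B)%fset) :
  simple_graph e -> amplitudes e psi -> z \notin B -> e x z ->
  (forall y, y \in B -> e y z -> y = x) ->
  psi_vec e psi (z |` B)%fset w =
    psi x z (w [` fset1Ur z xB]%fset) (w [` fset1U1 z B]%fset) *
    psi_vec e psi B (restr (fsubsetU1 z B) w).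
Proof.
move=> sg amp zB exz leaf.
pose f y := if insub y is Some y' then w y' else w [` fset1U1 z B]%fset.
have wf (y : (z |` B)%fset) : w y = f (val y) by rewrite /f valK.
rewrite (@psi_vecE _ _ _ e psi _ f) // (amplitude_leaf (x := x)) //.
rewrite !wf /=; congr (_ * _); apply/esym/psi_vecE => y.
by rewrite ffunE wf.
Qed.

Lemma restr_glue (d : nat) (L : choiceType) (A B C : {fset L})
    (BC : (B `<=` C)%fset) (u : conf d A) (w : conf d C) :
  restr BC (Defs.glue u w) = Defs.glue u (restr BC w).
Proof.
by apply/ffunP => y; rewrite !ffunE /=; case: insub => // ?; rewrite ffunE.
Qed.

Lemma restr_trans (d : nat) (L : choiceType) (A B C : {fset L})
    (AB : (A `<=` B)%fset) (BC : (B `<=` C)%fset) (AC : (A `<=` C)%fset)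
    (w : conf d C) :
  restr AB (restr BC w) = restr AC w.
Proof. by apply/ffunP => y; rewrite !ffunE; congr (w _); apply: val_inj. Qed.

Lemma glue_notin (d : nat) (L : choiceType) (A B : {fset L})
    (u : conf d A) (w : conf d B) (y : B) :
  val y \notin A -> Defs.glue u w y = w y.
Proof. by move=> yA; rewrite ffunE insubN. Qed.

(** As x and z lie outside A, the new factor depends only on the variables
that a keeps fixed, so it passes through a as a scalar. *)
Lemma extend_psi_leaf (K : numClosedFieldType) (d : nat) (L : countType)
    (e : rel L) (psi : L -> L -> 'M[K]_d) (A B : {fset L}) (x z : L)
    (AB : (A `<=` B)%fset) (AC : (A `<=` z |` B)%fset) (a : local_alg K d A)
    (xB : x \in B) (w : conf d (z |` B)%fset) :
  simple_graph e -> amplitudes e psi -> z \notin B -> e x z ->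
  (forall y, y \in B -> e y z -> y = x) -> x \notin A ->
  extend AC a (psi_vec e psi (z |` B)%fset) w =
    psi x z (w [` fset1Ur z xB]%fset) (w [` fset1U1 z B]%fset) *
    extend AB a (psi_vec e psi B) (restr (fsubsetU1 z B) w).
Proof.
move=> sg amp zB exz leaf xA; have zA : z \notin A.
  by apply: contraNN zB => /(fsubsetP AB).
rewrite !extendE (restr_trans _ _ AC).
set c := psi x z _ _.
have -> : [ffun u : conf d A => psi_vec e psi (z |` B)%fset (Defs.glue u w)] =
    c *: ([ffun u => psi_vec e psi B (Defs.glue u (restr (fsubsetU1 z B) w))]
            : hilb K d A).
  apply/ffunP => u; rewrite ffunE (psi_vec_leaf xB) // !glue_notin //.
  by rewrite restr_glue !ffunE.
by rewrite linearZ ffunE.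
Qed.

(** Fubini for configurations: one on B together with the value at z. *)
Lemma sum_conf_fsetU1 (K : numClosedFieldType) (d : nat) (L : choiceType)
    (B : {fset L}) (z : L) (F : conf d B -> 'I_d -> K) :
  z \notin B ->
  \sum_(w : conf d (z |` B)%fset)
     F (restr (fsubsetU1 z B) w) (w [` fset1U1 z B]%fset) =
  \sum_w \sum_k F w k.
Proof.
move=> zB; rewrite pair_big /=.
pose g (w : conf d (z |` B)%fset) :=
  (restr (fsubsetU1 z B) w, w [` fset1U1 z B]%fset).
rewrite [RHS](reindex g) //=; apply: onW_bij; apply: inj_card_bij.
  move=> w w' [eqB eqz]; apply/ffunP => -[y yC].
  case/fset1UP: (yC) => [yz|yB].
    by move: eqz; congr (_ = _); congr (_ _); apply: val_inj; rewrite /= yz.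
  have := congr1 (fun v : conf d B => v [` yB]%fset) eqB; rewrite !ffunE.
  by congr (_ = _); congr (_ _); apply: val_inj.
rewrite card_prod !card_ffun !card_ord -!cardfE cardfsU1 zB /=.
by rewrite add1n expnS mulnC.
Qed.

Lemma expectE (K : numClosedFieldType) (d : nat) (L : countType)
    (e : rel L) (psi : L -> L -> 'M[K]_d) (A B : {fset L})
    (AB : (A `<=` B)%fset) (a : local_alg K d A) :
  expect e psi a B = inner (psi_vec e psi B) (extend AB a (psi_vec e psi B)).
Proof.
rewrite /expect; case: {-}_ / idP => [h|//].
by rewrite (bool_irrelevance h AB).
Qed.

(** The new factor occurs on both sides of the inner product, so it
contributes its squared modulus, and the sum over the value at z is a row sum
of the amplitude matrix, which is 1. *)
Lemma expect_leaf (K : numClosedFieldType) (d : nat) (L : countType)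
    (e : rel L) (psi : L -> L -> 'M[K]_d) (A B : {fset L}) (x z : L)
    (a : local_alg K d A) :
  simple_graph e -> amplitudes e psi -> (A `<=` B)%fset ->
  x \in B -> z \notin B -> e x z -> (forall y, y \in B -> e y z -> y = x) ->
  x \notin A ->
  expect e psi a (z |` B)%fset = expect e psi a B.
Proof.
move=> sg amp AB xB zB exz leaf xA.
have AC := fsubset_trans AB (fsubsetU1 z B).
rewrite (expectE _ _ AC) (expectE _ _ AB) /inner.
set v := psi_vec e psi B.
pose F (w : conf d B) (k : 'I_d) :=
  `|psi x z (w [` xB]%fset) k| ^+ 2 * ((v w)^* * extend AB a v w).
transitivity (\sum_w \sum_k F w k); last first.
  apply: eq_bigr => w _; rewrite -mulr_suml.
  by have [[_ ->] _] := amp x z exz; rewrite mul1r.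
rewrite -(sum_conf_fsetU1 F zB); apply: eq_bigr => w _.
rewrite (extend_psi_leaf AB _ _ xB) //.
rewrite (psi_vec_leaf xB) // rmorphM /F normCKC mulrACA.
congr (_ * _); congr (_ * _); rewrite ffunE; first congr (psi x z _ _)^*.
  by congr (w _); apply: val_inj.
by congr (psi x z (w _) _); apply: val_inj.
Qed.

Lemma extend1 (K : numClosedFieldType) (d : nat) (L : choiceType)
    (A B : {fset L}) (AB : (A `<=` B)%fset) (v : hilb K d B) :
  extend AB \1%VF v = v.
Proof.
apply/ffunP => w; rewrite extendE id_lfunE ffunE; congr (v _).
apply/ffunP => y; rewrite ffunE; case: insubP => // x _ xy.
by rewrite ffunE; congr (w _); apply: val_inj; rewrite /= -xy.
Qed.

(** The squared norm is the expectation of the identity acting on the empty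
set, to which every leaf attachment applies; on a single vertex psi is
constantly 1 and has squared norm d. *)
Lemma norm_psi_vec (K : numClosedFieldType) (d : nat) (L : countType)
    (e : rel L) (psi : L -> L -> 'M[K]_d) (B : {fset L}) :
  tree e -> amplitudes e psi -> connected_in e B -> B != fset0 ->
  inner (psi_vec e psi B) (psi_vec e psi B) = d%:R.
Proof.
move=> treee amp cB /fset0Pn[x xB].
have [sg _ _] := treee; have [syme irre] := sg.
pose one : local_alg K d (@fset0 L) := \1%VF.
suff : expect e psi one B = d%:R.
  by rewrite (expectE _ _ (fsub0set B)) extend1.
have x1 : [fset x]%fset != fset0 by apply/fset0Pn; exists x; rewrite fset11.
have xsB : ([fset x] `<=` B)%fset by rewrite fsub1set.
apply: (connected_growth_ind (P := fun C => expect e psi one C = d%:R)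
  syme (@connected_in1 L e x) x1 cB xsB)
  => [|D y z cD xD yD zD eyz <-].
  rewrite (expectE _ _ (fsub0set _)) extend1 /inner.
  have psi1 w : psi_vec e psi [fset x]%fset w = 1.
    rewrite ffunE big_pred0 // => -[u v] /=.
    by rewrite (fset1P _ _ (valP u)) (fset1P _ _ (valP v)) irre.
  under eq_bigr do rewrite psi1 rmorph1 mulr1.
  by rewrite sumr_const card_ffun card_ord -cardfE cardfs1 expn1.
apply: (expect_leaf (x := y)) => //.
by move=> u uD euz; exact: (tree_leaf_unique treee cD zD).
Qed.

(** D contains A and all neighbours of A.  A vertex outside D is then adjacent
to no vertex of A, so each attachment beyond D is of the kind that leaves the
expectation unchanged. *)
Lemma expect_stable (K : numClosedFieldType) (d : nat) (L : countType)
    (e : rel L) (psi : L -> L -> 'M[K]_d) (A : {fset L}) (a : local_alg K d A) :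
  inhabited L -> locally_finite e -> tree e -> amplitudes e psi ->
  exists D : {fset L}, [/\ connected_in e D, (A `<=` D)%fset, D != fset0 &
    forall B, connected_in e B -> (D `<=` B)%fset ->
      expect e psi a B = expect e psi a D].
Proof.
move=> inhL lf treee amp; have [sg conn _] := treee; have [syme _] := sg.
have [N NP] := locally_finite_nbh A lf.
have [D [cD /fsubUsetP[AD ND] D0]] :=
  connected_hull (A `|` N)%fset inhL syme conn.
exists D; split=> // B cB DB.
apply: (connected_growth_ind (P := fun C => expect e psi a C = expect e psi a D)
  syme cD D0 cB DB) => // C x z cC DC xC zC exz <-.
have xA : x \notin A.
  by apply: contraNN zC => xA; apply/(fsubsetP DC)/(fsubsetP ND)/(NP x).
apply: (expect_leaf (x := x)) => //; first exact: fsubset_trans DC.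
by move=> u uC euz; exact: (tree_leaf_unique treee cC zC).
Qed.

Lemma exhaustion_proper (L : choiceType) (e : rel L) :
  inhabited L -> symmetric e -> connected_graph e ->
  ProperFilter (exhaustion e).
Proof.
move=> inhL syme conn; apply: filter_from_proper; last first.
  move=> A _; have [D [cD AD _]] := connected_hull A inhL syme conn.
  by exists D.
apply: filter_from_filter; first by exists fset0.
move=> A B _ _; exists (A `|` B)%fset => // D [cD /fsubUsetP[AD BD]].
by split.
Qed.

Lemma exhaustion_near (L : choiceType) (e : rel L) (A : {fset L}) :
  \forall B \near exhaustion e, connected_in e B /\ (A `<=` B)%fset.
Proof. by exists A. Qed.

(** * Vector functionals and the norm of a C*-inductive limit *)

Section Inner.
Variables (K : numClosedFieldType) (d : nat) (L : choiceType) (A : {fset L}).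
Implicit Types (u v : hilb K d A) (a : local_alg K d A).

Lemma inner_linear u : linear (inner u : hilb K d A -> K^o).
Proof.
move=> c x y; rewrite /inner scaler_sumr -big_split /=; apply: eq_bigr => i _.
by rewrite !ffunE mulrDr /GRing.scale /= mulrCA.
Qed.

Lemma inner_conj u v : (inner u v)^* = inner v u.
Proof.
rewrite /inner rmorph_sum; apply: eq_bigr => w _.
by rewrite rmorphM /= conjCK mulrC.
Qed.

Lemma inner_ge0 u : 0 <= inner u u.
Proof. by apply: sumr_ge0 => w _; rewrite mulrC mul_conjC_ge0. Qed.

Lemma inner_basis (w : conf d A) v : inner (basis_vec K w) v = v w.
Proof.
rewrite /inner (bigD1 w) //= big1 ?addr0.
  by rewrite ffunE eqxx rmorph1 mul1r.
by move=> i ni; rewrite ffunE (negbTE ni) rmorph0 mul0r.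
Qed.

Lemma inner_inj v v' : (forall u, inner u v = inner u v') -> v = v'.
Proof. by move=> vv'; apply/ffunP => w; rewrite -!inner_basis vv'. Qed.

Lemma inner0r u : inner u 0 = 0.
Proof. by rewrite /inner big1 // => w _; rewrite ffunE mulr0. Qed.

Lemma innerZr u c v : inner u (c *: v) = c * inner u v.
Proof. by have := inner_linear u c v 0; rewrite inner0r !addr0. Qed.

Lemma innerZl u c v : inner (c *: u) v = c^* * inner u v.
Proof. by rewrite -inner_conj innerZr rmorphM /= inner_conj. Qed.

Definition rank_one v : local_alg K d A :=
  linfun (fun u : hilb K d A => inner v u *: v).

Lemma rank_oneE v u : rank_one v u = inner v u *: v.
Proof.
have lf : linear (fun u : hilb K d A => inner v u *: v).
  by move=> c x y; rewrite inner_linear scalerDl scalerA.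
pose mf := GRing.isLinear.Build K (hilb K d A) (hilb K d A) _ _ lf.
pose lF : {linear hilb K d A -> hilb K d A} :=
  HB.pack (fun u : hilb K d A => inner v u *: v) mf.
have -> : rank_one v = linfun lF by [].
by rewrite lfunE.
Qed.

Lemma adj_rank_one v : adj (rank_one v) = rank_one v.
Proof.
apply/lfunP => u; apply: inner_inj => u'.
by rewrite adjP !rank_oneE innerZl innerZr inner_conj mulrC.
Qed.

(** Compressing to the line through v turns every operator into a scalar; this
scalar is the vector expectation. *)
Lemma rank_one_sandwich v a :
  (rank_one v \o (a \o rank_one v))%VF = inner v (a v) *: rank_one v.
Proof.
apply/lfunP => u; rewrite comp_lfunE comp_lfunE scale_lfunE !rank_oneE.
by rewrite linearZ innerZr scalerA mulrC.
Qed.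

Lemma rank_one_eq0 v : rank_one v = 0 -> inner v v = 0.
Proof.
move=> /lfunP/(_ v); rewrite rank_oneE lfunE /= => vv0.
have : inner v (inner v v *: v) = 0 by rewrite vv0 inner0r.
by rewrite innerZr => /eqP; rewrite mulf_eq0 orbb => /eqP.
Qed.

End Inner.

(** The embedding transports |v><v| to a self-adjoint p with p p = <v, v> p, so
that |p| = <v, v> by the C*-identity, since p is nonzero for v nonzero.  The
identity p (iota a) p = <v, a v> p and submultiplicativity then bound
<v, a v>. *)
Lemma inner_iota_le (K : numClosedFieldType) (d : nat) (L : choiceType)
    (BL : cstarAlgType K) (iota : forall A : {fset L}, local_alg K d A -> BL)
    (A : {fset L}) (v : hilb K d A) (a : local_alg K d A) :
  inductive_limit iota ->
  `|inner v (a v)| <= inner v v * `|iota A a|.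
Proof.
move=> lim; have linZ c x : iota A (c *: x) = c *: iota A x.
  have lin := iota_linear lim (A := A); have := lin c x 0.
  have := lin (-1) 0 0; rewrite scaler0 addr0 scaleN1r addNr => ->.
  by rewrite !addr0.
have [vv0|vv0] := eqVneq (inner v v) 0.
  have v0 : v = 0.
    apply/ffunP => w; rewrite !ffunE; apply/eqP.
    move/eqP: vv0; rewrite psumr_eq0 => [/allP/(_ w)|? _].
      by rewrite mem_index_enum mulrC mul_conjC_eq0 => /(_ isT).
    by rewrite mulrC mul_conjC_ge0.
  by rewrite vv0 v0 linear0 inner0r normr0 mul0r.
set p := iota A (rank_one v).
have pap x : cmul p (cmul (iota A x) p) = inner v (x v) *: p.
  by rewrite -!(iotaM lim) rank_one_sandwich linZ.
have p0 : 0 < `|p|.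
  rewrite normr_gt0; apply: contra_neq vv0 => p0; apply: rank_one_eq0.
  by apply: (iota_inj lim); rewrite -/p p0 -(scale0r (rank_one v)) linZ scale0r.
have normp : `|p| = inner v v.
  have starp : star p = p by rewrite -(iota_star lim) adj_rank_one.
  (* p* p = p 1 p, to which the sandwich identity applies with x = 1. *)
  have := norm_star_cmul p; rewrite starp -[X in cmul X _](cmul1r p) -cmulA.
  rewrite -(iota1 lim A) pap id_lfunE normrZ ger0_norm ?inner_ge0 // expr2.
  by move=> /(mulIf (lt0r_neq0 p0)) ->.
rewrite -normp -(ler_pM2r p0) -normrZ -pap.
rewrite -mulrA; apply: le_trans (norm_cmul_le _ _) _.
by rewrite ler_wpM2l // norm_cmul_le.
Qed.

(** * Extension of a bounded functional from a dense subspace *)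

Lemma le_Re (R : rcfType) (a b : R[i]) : a <= b -> complex.Re a <= complex.Re b.
Proof. by rewrite lecE => /andP[_]. Qed.

(** The McShane extension m b = inf_y (h y + |b - y|).  The norm takes its
values in R[i]; its real part is used to speak of infima in R. *)
Lemma lipschitz_extension (R : realType) (V : normedModType R[i]) (S : set V)
    (h : V -> R) :
  S !=set0 ->
  (forall x y, S x -> S y -> `|h x - h y| <= complex.Re `|x - y|) ->
  exists m : V -> R, forall b x, S x -> `|m b - h x| <= complex.Re `|b - x|.
Proof.
move=> [x0 Sx0] hlip; pose E b := [set h y + complex.Re `|b - y| | y in S].
have lbE b x : S x -> lbound (E b) (h x - complex.Re `|b - x|).
  move=> Sx _ [y Sy <-]; rewrite lerBlDr.
  have : complex.Re `|x - y| <= complex.Re `|b - x| + complex.Re `|b - y|.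
    by rewrite -raddfD; apply: le_Re; rewrite (distrC b x) ler_distD.
  by move: (hlip x y Sx Sy); rewrite ler_norml; lra.
exists (fun b => inf (E b)) => b x Sx; rewrite ler_distl; apply/andP; split.
  by apply: lb_le_inf (lbE b x Sx); exists (h x0 + complex.Re `|b - x0|), x0.
apply: ge_inf; last by exists x.
by exists (h x - complex.Re `|b - x|); exact: lbE.
Qed.

Lemma dense_near (T : topologicalType) (S P : set T) (b : T) :
  dense S -> nbhs b P -> exists2 x, S x & P x.
Proof.
move=> dS; rewrite nbhsE => -[U [oU Ub] UP].
by have [x [Ux Sx]] := dS U (ex_intro _ b Ub) oU; exists x => //; exact: UP.
Qed.

Lemma dense_approx (K : numFieldType) (V : normedModType K) (S : set V) (b : V)
    (eps : K) :
  dense S -> 0 < eps -> exists2 x, S x & `|b - x| < eps.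
Proof.
move=> dS eps0; apply: (@dense_near _ S (fun x => `|b - x| < eps) b dS).
by apply: cvgr_dist_lt eps0; exact: cvg_id.
Qed.

Lemma norm_small_eq0 (K : numFieldType) (V : normedModType K) (t : V) (C : K) :
  0 < C -> (forall eps, 0 < eps -> `|t| <= C * eps) -> t = 0.
Proof.
move=> C0 small; have [//|] := eqVneq t 0; rewrite -normr_gt0 => t0.
have := small (`|t| / (2 * C)) (divr_gt0 t0 (mulr_gt0 (ltr0Sn _ 1) C0)).
have -> : C * (`|t| / (2 * C)) = `|t| / 2 by field; rewrite gt_eqF.
move=> le_half; have : `|t| < `|t|; last by rewrite ltxx.
apply: le_lt_trans le_half _; rewrite ltr_pdivrMr ?ltr0Sn //.
by rewrite mulr_natr mulr2n ltrDl.
Qed.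

Lemma norm_i (R : rcfType) : `|'i%C : R[i]| = 1.
Proof. by rewrite normc_def /= expr0n expr1n add0r sqrtr1. Qed.

Lemma norm_real_complex (R : rcfType) (x : R) : `|x%:C%C| = `|x|%:C%C.
Proof. by rewrite normc_def /= expr0n addr0 sqrtr_sqr. Qed.

Lemma norm_real_complex_le (R : rcfType) (x : R) (V : normedZmodType R[i])
    (v : V) :
  `|x| <= complex.Re `|v| -> `|x%:C%C| <= `|v|.
Proof.
move=> xv; rewrite norm_real_complex -(RRe_real (ger0_real (normr_ge0 v))).
by rewrite lecR.
Qed.

(** The real part of g extends by [lipschitz_extension] to a real function m,
and g is recovered from its real part as g x = Re (g x) - i Re (g (i x)); so
f b = m b - i m (i b) satisfies |f b - g x| <= 2 |b - x| for x in S.  The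
linearity of f follows from this estimate by letting x tend to b. *)
Lemma bounded_extension (R : realType) (V : normedModType R[i]) (S : set V)
    (g : V -> R[i]) :
  S 0 -> (forall c x y, S x -> S y -> S (c *: x + y)) -> dense S ->
  (forall c x y, S x -> S y -> g (c *: x + y) = c * g x + g y) ->
  (forall x, S x -> `|g x| <= `|x|) ->
  exists phi : {linear V -> R[i]^o},
    continuous phi /\ forall x, S x -> phi x = g x.
Proof.
move=> S0 SL dS gL gb.
have gB x y : S x -> S y -> `|g x - g y| <= `|x - y|.
  move=> Sx Sy; have -> : g x - g y = g (x - y).
    by rewrite [x - y]addrC -(scaleN1r y) gL // mulN1r addrC.
  by apply: gb; rewrite addrC -scaleN1r; exact: SL.
have SZ c x : S x -> S (c *: x) by move=> Sx; rewrite -[_ *: _]addr0; exact: SL.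
have g0 : g 0 = 0 by apply/eqP; rewrite -normr_le0 -(normr0 V); exact: gb.
have gZ c x : S x -> g (c *: x) = c * g x.
  by move=> Sx; rewrite -[_ *: _]addr0 gL // g0 addr0.
have [||m mP] := @lipschitz_extension _ V S (fun x => complex.Re (g x)).
- by exists 0.
- move=> x y Sx Sy; rewrite -raddfB; apply: le_trans (le_Re (gB x y Sx Sy)).
  by have := le_Re (normc_ge_Re (g x - g y)).
pose f b : R[i]^o := (m b)%:C%C - 'i%C * (m ('i%C *: b))%:C%C.
have fP b x : S x -> `|f b - g x| <= 2 * `|b - x|.
  move=> Sx; have -> : f b - g x =
      (m b - complex.Re (g x))%:C%C
      - 'i%C * (m ('i%C *: b) - complex.Re (g ('i%C *: x)))%:C%C.
    rewrite gZ // (mulrC _ (g x)) ReiNIm opprK {1}[g x]complexE /f.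
    by rewrite !rmorphB rmorphD /=; ring.
  apply: le_trans (ler_normB _ _) _.
  rewrite mulr_natl mulr2n normrM norm_i mul1r.
  apply: lerD; apply: norm_real_complex_le; first exact: mP.
  have -> : complex.Re `|b - x| = complex.Re `|'i%C *: b - 'i%C *: x|.
    by rewrite -scalerBr normrZ norm_i mul1r.
  exact/mP/SZ.
have fL : linear f.
  move=> c b b'; apply/eqP; rewrite -subr_eq0; apply/eqP.
  (* The errors 2 |c b + b' - (c x + y)|, 2 |c| |b - x| and 2 |b' - y| add up
     to at most (4 |c| + 4) eps. *)
  apply: (@norm_small_eq0 _ R[i]^o _ (4 * `|c| + 4)).
    by rewrite ltr_wpDl ?mulr_ge0.
  move=> eps eps0.
  have [x Sx bx] := dense_approx b dS eps0.
  have [y Sy b'y] := dense_approx b' dS eps0.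
  have -> : f (c *: b + b') - (c *: f b + f b') =
      (f (c *: b + b') - g (c *: x + y)) - (c * (f b - g x) + (f b' - g y)).
    by rewrite gL // /GRing.scale /=; ring.
  apply: le_trans (ler_normB _ _) _.
  have : `|c * (f b - g x) + (f b' - g y)| <= `|c| * (2 * eps) + 2 * eps.
    apply: le_trans (ler_normD _ _) _; rewrite normrM; apply: lerD.
      rewrite ler_wpM2l //; apply: le_trans (fP b x Sx) _.
      by rewrite ler_wpM2l // ltW.
    by apply: le_trans (fP b' y Sy) _; rewrite ler_wpM2l // ltW.
  have : `|f (c *: b + b') - g (c *: x + y)| <= 2 * (`|c| * eps + eps).
    apply: le_trans (fP _ _ (SL c x y Sx Sy)) _; rewrite ler_wpM2l //.
    rewrite opprD addrACA -scalerBr; apply: le_trans (ler_normD _ _) _.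
    by rewrite normrZ lerD ?ler_wpM2l // ltW.
  move=> h1 h2; apply: le_trans (lerD h1 h2) _.
  rewrite le_eqVlt; apply/orP; left; apply/eqP; ring.
pose mf := GRing.isLinear.Build _ _ _ _ f fL.
pose phi : {linear V -> R[i]^o} := HB.pack f mf.
exists phi; split; last first.
  move=> x Sx; apply/eqP; rewrite -subr_eq0 -normr_le0.
  by apply: le_trans (fP x x Sx) _; rewrite subrr normr0 mulr0.
apply: bounded_linear_continuous; apply/linear_boundedP; near=> r => x.
apply: (@le_trans _ _ (2 * `|x|)).
  by have := fP x 0 S0; rewrite g0 !subr0.
by rewrite ler_wpM2r //; near: r; exact: nbhs_pinfty_ge.
Unshelve. all: by end_near.
Qed.

Lemma continuous_dense_eq (K : numFieldType) (V W : normedModType K)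
    (S : set V) (f g : V -> W) :
  dense S -> continuous f -> continuous g -> (forall x, S x -> f x = g x) ->
  f =1 g.
Proof.
move=> dS cf cg fg b; apply/eqP; rewrite -subr_eq0; apply: contrapT => fgb.
have cfg : continuous (f - g) by move=> x; apply: cvgB; [exact: cf|exact: cg].
have op : open ((f - g) @^-1` (~` [set 0])).
  apply: open_comp; first by move=> x _; exact: cfg.
  exact/closed_openC/accessible_closed_set1/hausdorff_accessible/norm_hausdorff.
have [|x [/= fgx Sx]] := dS _ _ op; first by exists b => /= /eqP.
by apply: fgx; rewrite !fctE fg // subrr.
Qed.

(** * Positivity on a dense subspace *)

(** The nonnegative reals form a closed subset of the complex plane. *)
Lemma ge0_approx (R : rcfType) (z : R[i]) :
  (forall eps, 0 < eps -> exists2 w : R[i], 0 <= w & `|z - w| <= eps) -> 0 <= z.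
Proof.
move=> approx; rewrite lecE /=.
have near0 (eps : R) : 0 < eps ->
    `|complex.Im z| <= eps /\ - eps <= complex.Re z.
  move=> eps0; have [|w w0 zw] := approx eps%:C%C; first by rewrite ltcR.
  have /eqP Imw : complex.Im w == 0 by move: w0; rewrite lecE => /andP[].
  have Rew : 0 <= complex.Re w by move: w0; rewrite lecE => /andP[_].
  split.
    have := normc_ge_Re ((z - w) * 'i%C); rewrite normrM.
    rewrite norm_i mulr1 ReiNIm normrN raddfB /= Imw subr0 => /le_trans/(_ zw).
    by rewrite lecR.
  have := le_trans (normc_ge_Re (z - w)) zw; rewrite lecR raddfB /= ler_norml.
  by move=> /andP[+ _]; lra.
apply/andP; split.
  rewrite -normr_le0; apply/ler_addgt0Pl => eps /near0[]; rewrite addr0.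
  by move=> + _.
by apply/ler_addgt0Pl => eps /near0[_]; lra.
Qed.

(** |x|^2 = |x* x| <= |x*| |x| gives |x| <= |x*|, and the involution gives the
converse. *)
Lemma norm_star (K : numClosedFieldType) (B : cstarAlgType K) (b : B) :
  `|star b| = `|b|.
Proof.
have le x : `|x : B| <= `|star x|.
  have [->|x0] := eqVneq x 0; first by rewrite normr0.
  rewrite -(ler_pM2r (x := `|x|)) ?normr_gt0 // -expr2 -norm_star_cmul.
  exact: norm_cmul_le.
by apply/eqP; rewrite eq_le le -{2}[b]starK le.
Qed.

Lemma star_cmul_dist (K : numClosedFieldType) (B : cstarAlgType K) (b x : B) :
  `|cmul (star b) b - cmul (star x) x| <= `|b - x| * (`|b| *+ 2 + `|b - x|).
Proof.
set y := b - x; have -> : x = b + - y by rewrite opprB addrC subrK.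
have starN (u : B) : star (- u) = - star u.
  by rewrite -scaleN1r starZ rmorphN rmorph1 scaleN1r.
have cmulNl (u v : B) : cmul (- u) v = - cmul u v.
  by rewrite -scaleN1r cmulZl scaleN1r.
have cmulNr (u v : B) : cmul u (- v) = - cmul u v.
  by rewrite -scaleN1r cmulZr scaleN1r.
rewrite starD starN cmulDr !cmulDl !cmulNl !cmulNr opprK.
set bb := cmul _ b.
(* With y = b - x the difference is y* b + b* y - y* y. *)
have -> : bb - (bb - cmul (star y) b + (- cmul (star b) y + cmul (star y) y)) =
    cmul (star y) b + cmul (star b) y - cmul (star y) y.
  by rewrite !opprD !opprK !addrA subrr add0r.
apply: le_trans (ler_normB _ _) _; rewrite mulrDr mulrnAr mulr2n.
have le_mul u v : `|cmul (star u) v| <= `|u| * `|v|.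
  by rewrite -(norm_star u) norm_cmul_le.
apply: lerD; last exact: le_mul.
apply: le_trans (ler_normD _ _) _; apply: lerD; first exact: le_mul.
by rewrite mulrC le_mul.
Qed.

Lemma star_cmul_continuous (K : numClosedFieldType) (B : cstarAlgType K) :
  continuous (fun b : B => cmul (star b) b).
Proof.
move=> b; apply/cvgrPdist_lt => eps eps0; near=> x.
apply: le_lt_trans (star_cmul_dist b x) _.
have C0 : 0 < `|b| *+ 2 + 1 by rewrite ltr_wpDl // mulrn_wge0.
apply: (@le_lt_trans _ _ (`|b - x| * (`|b| *+ 2 + 1))).
  rewrite ler_wpM2l // lerD2l ltW //; near: x; exact: cvgr_dist_lt.
rewrite -ltr_pdivlMr //; near: x; apply: cvgr_dist_lt => //.
exact: divr_gt0.
Unshelve. all: by end_near.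
Qed.

Lemma ge0_dense (R : realType) (B : cstarAlgType R[i]) (S : set B)
    (phi : {linear B -> R[i]^o}) :
  dense S -> continuous phi ->
  (forall x, S x -> 0 <= (phi (cmul (star x) x) : R[i])) ->
  forall b, 0 <= (phi (cmul (star b) b) : R[i]).
Proof.
move=> dS cphi pos b; apply: ge0_approx => eps eps0.
have cb : phi (cmul (star x) x) @[x --> b] --> phi (cmul (star b) b).
  by apply: (@cvg_comp _ _ _ (fun x => cmul (star x) x) phi _
               (nbhs (cmul (star b) b)));
    [exact: star_cmul_continuous|exact: cphi].
have [|x Sx bx] := @dense_near _ S
    (fun x => `|phi (cmul (star b) b) - phi (cmul (star x) x)| < eps) b dS.
  by apply: cvgr_dist_lt.
by exists (phi (cmul (star x) x)); [exact: pos|exact: ltW].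
Qed.

(** * The limit functional on the local observables *)

Section LocalValue.
Variables (K : numClosedFieldType) (d : nat) (L : countType) (e : rel L).
Variables (psi : L -> L -> 'M[K]_d) (BL : cstarAlgType K).
Variable iota : forall A : {fset L}, local_alg K d A -> BL.
Arguments iota : clear implicits.
Hypotheses (d0 : (0 < d)%N) (inhL : inhabited L) (lf : locally_finite e).
Hypotheses (treee : tree e) (amp : amplitudes e psi).
Hypothesis lim : inductive_limit iota.

Let d0K : 0 < d%:R :> K. Proof. by rewrite ltr0n. Qed.

(** By injectivity of the embeddings at most one operator on B represents b, so
the value l is read off without choosing a finite set that supports b.
Finitely many observables are compared on one common large B, so each property
of the limit reduces to the same property of a single vector expectation. *)
Definition local_value (b : BL) (l : K) :=
  \forall B \near exhaustion e, exists2 a : local_alg K d B,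
    iota B a = b & d%:R^-1 * inner (psi_vec e psi B) (a (psi_vec e psi B)) = l.

Let exhaustion_proper' : ProperFilter (exhaustion e).
Proof. by have [[syme _] conn _] := treee; exact: exhaustion_proper. Qed.
#[local] Existing Instance exhaustion_proper'.

Lemma expect_eventually (A : {fset L}) (a : local_alg K d A) :
  exists l, \forall B \near exhaustion e, d%:R^-1 * expect e psi a B = l.
Proof.
have [D [_ _ _ DP]] := expect_stable a inhL lf treee amp.
exists (d%:R^-1 * expect e psi a D).
by apply: filterS (exhaustion_near e D) => B [cB DB]; rewrite DP.
Qed.

Lemma local_value_expect (A : {fset L}) (a : local_alg K d A) (l : K) :
  (\forall B \near exhaustion e, d%:R^-1 * expect e psi a B = l) ->
  local_value (iota A a) l.
Proof.
move=> al; near=> B.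
have AB : (A `<=` B)%fset.
  by near: B; apply: filterS (exhaustion_near e A) => B [].
exists (extend AB a); first exact: (iota_extend lim).
by rewrite -expectE; near: B.
Unshelve. all: by end_near.
Qed.

Lemma local_value_uniq (b : BL) (l l' : K) :
  local_value b l -> local_value b l' -> l = l'.
Proof.
move=> bl bl'; near (exhaustion e) => B.
have [a ab <-] : exists2 a : local_alg K d B, iota B a = b &
  d%:R^-1 * inner (psi_vec e psi B) (a (psi_vec e psi B)) = l by near: B.
have [a' a'b <-] : exists2 a : local_alg K d B, iota B a = b &
  d%:R^-1 * inner (psi_vec e psi B) (a (psi_vec e psi B)) = l' by near: B.
by have /(iota_inj lim)-> : iota B a = iota B a' by rewrite ab a'b.
Unshelve. all: by end_near.
Qed.

Lemma local_value_linear (c : K) (b b' : BL) (l l' : K) :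
  local_value b l -> local_value b' l' ->
  local_value (c *: b + b') (c * l + l').
Proof.
move=> bl bl'; apply: filterS2 bl bl' => B [a <- <-] [a' <- <-].
exists (c *: a + a'); first exact: (iota_linear lim).
by rewrite lfunE /= lfunE /= inner_linear /GRing.scale /= mulrDr mulrCA.
Qed.

Lemma norm_psi_near : \forall B \near exhaustion e,
  inner (psi_vec e psi B) (psi_vec e psi B) = d%:R.
Proof.
case: inhL => x; apply: filterS (exhaustion_near e [fset x]%fset) => B [cB].
by rewrite fsub1set => xB; apply: norm_psi_vec => //; apply/fset0Pn; exists x.
Qed.

Lemma local_value_le (b : BL) (l : K) : local_value b l -> `|l| <= `|b|.
Proof.
move=> bl; near (exhaustion e) => B.
have [a <- <-] : exists2 a : local_alg K d B, iota B a = b &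
  d%:R^-1 * inner (psi_vec e psi B) (a (psi_vec e psi B)) = l by near: B.
rewrite normrM normfV normr_nat ler_pdivrMl //.
have <- : inner (psi_vec e psi B) (psi_vec e psi B) = d%:R.
  by near: B; exact: norm_psi_near.
exact: inner_iota_le.
Unshelve. all: by end_near.
Qed.

Lemma local_value_ge0 (b : BL) (l l' : K) :
  local_value b l -> local_value (cmul (star b) b) l' -> 0 <= l'.
Proof.
move=> bl bl'; near (exhaustion e) => B.
have [a ab _] : exists2 a : local_alg K d B, iota B a = b &
  d%:R^-1 * inner (psi_vec e psi B) (a (psi_vec e psi B)) = l by near: B.
have [a' a'b <-] : exists2 a : local_alg K d B,
  iota B a = cmul (star b) b &
  d%:R^-1 * inner (psi_vec e psi B) (a (psi_vec e psi B)) = l' by near: B.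
have /(iota_inj lim)-> : iota B a' = iota B (adj a \o a)%VF.
  by rewrite a'b (iotaM lim) (iota_star lim) ab.
by rewrite comp_lfunE adjP mulr_ge0 ?inner_ge0 // invr_ge0 ltW.
Unshelve. all: by end_near.
Qed.

Lemma local_value1 : local_value (cone BL) 1.
Proof.
apply: filterS norm_psi_near => B normB; exists \1%VF; first exact: (iota1 lim).
by rewrite id_lfunE normB mulVf // gt_eqF.
Qed.

End LocalValue.

(** * The limit state *)

Theorem corollary5p4 (R : realType) (d : nat) (L : countType) (e : rel L)
    (psi : L -> L -> 'M[R[i]]_d) :
  (0 < d)%N -> inhabited L -> locally_finite e -> tree e ->
  amplitudes e psi ->
  [/\ (forall A : {fset L}, connected_in e A -> (2 <= #|` A|)%N ->
         inner (psi_vec e psi A) (psi_vec e psi A) = d%:R),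
      (forall (A : {fset L}) (a : local_alg R[i] d A),
         exists l : R[i]^o,
           (d%:R^-1 * expect e psi a B : R[i]^o) @[B --> exhaustion e] --> l)
    & (forall (BL : cstarAlgType R[i])
              (iota : forall A : {fset L}, local_alg R[i] d A -> BL),
         inductive_limit iota ->
         let extends (phi : {linear BL -> R[i]^o}) :=
           continuous phi /\
           forall (A : {fset L}) (a : local_alg R[i] d A),
             (d%:R^-1 * expect e psi a B : R[i]^o) @[B --> exhaustion e]
               --> phi (iota A a) in
         exists phi : {linear BL -> R[i]^o},
           [/\ is_state phi, extends phi
             & forall phi' : {linear BL -> R[i]^o},
                 extends phi' -> phi' =1 phi])].
Proof.
move=> d0 inhL lf treee amp; have [[syme _] conn _] := treee.
have exP : ProperFilter (exhaustion e) by exact: exhaustion_proper.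
have expl := expect_eventually inhL lf treee amp.
split.
- move=> A cA cardA; apply: norm_psi_vec => //.
  by rewrite -cardfs_gt0; exact: leq_trans cardA.
- by move=> A a; have [l al] := expl A a; exists l; exact: cvg_near_cst.
move=> BL iota lim extends.
pose S := \bigcup_(A in setT) range (iota A).
pose val := local_value e psi iota.
have valS b : S b -> exists l, val b l.
  move=> [A _ [a _ <-]]; have [l al] := expl A a; exists l.
  exact: local_value_expect.
pose g b := xget 0 (val b).
have gP b : S b -> val b (g b) by move=> /valS[l bl]; exact: xgetI bl.
have gE b l : S b -> val b l -> g b = l.
  by move=> /gP bg bl; exact: (local_value_uniq inhL treee lim bg bl).
have SL c b b' : S b -> S b' -> S (c *: b + b').
  move=> [A _ [a _ <-]] [A' _ [a' _ <-]]; exists (A `|` A')%fset => //.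
  exists (c *: extend (fsubsetUl A A') a + extend (fsubsetUr A A') a') => //.
  by rewrite (iota_linear lim) !(iota_extend lim).
have S0 : S 0.
  exists fset0 => //; exists 0 => //.
  have := iota_linear lim (A := fset0) (-1) 0 0.
  by rewrite scaler0 addr0 scaleN1r addNr.
have Smul b : S b -> S (cmul (star b) b).
  move=> [A _ [a _ <-]]; exists A => //; exists (adj a \o a)%VF => //.
  by rewrite (iotaM lim) (iota_star lim).
have dS : dense S := iota_dense lim.
have [||phi [cphi phiS]] := bounded_extension S0 SL dS (g := g).
- move=> c x y Sx Sy; apply: gE; first exact: SL.
  by apply: local_value_linear; try exact: gP.
- by move=> x Sx; apply: (local_value_le d0 inhL treee amp lim); exact: gP.
exists phi; split.
- split.
    apply: (ge0_dense dS cphi) => x Sx; rewrite phiS; last exact: Smul.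
    apply: (local_value_ge0 inhL treee lim (gP x Sx)).
    by apply: gP; exact: Smul.
  have S1 : S (cone BL).
    by exists fset0 => //; exists \1%VF; rewrite ?(iota1 lim).
  rewrite phiS //; apply: gE => //.
  exact: local_value1.
- split=> // A a; have [l al] := expl A a.
  have Sa : S (iota A a) by exists A => //; exists a.
  rewrite phiS // (gE _ l) //; first exact: cvg_near_cst.
  exact: local_value_expect.
- move=> phi' [cphi' phi'E]; apply: (continuous_dense_eq dS cphi' cphi).
  move=> _ [A _ [a _ <-]]; have [l al] := expl A a.
  rewrite phiS; last by exists A => //; exists a.
  rewrite (gE _ l); [|by exists A => //; exists a|exact: local_value_expect].
  apply: (cvg_unique _ (phi'E A a)); first exact: norm_hausdorff.
  exact: cvg_near_cst.
Qed.
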